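(* Suppose that the exact solution $(u,v)$ of the coupled nonlinear fractional Ginzburg-Landau problem (described in the context) is smooth enough, and let $\tau_0,h_0$ be the positive constants of the convergence estimate recalled in the context. Then there is a constant $C_*$, independent of $\tau$ and $h$, such that for $\tau=T/N<\tau_0$ and $h=(b-a)/M<h_0$ the solution $(U^n,V^n)$ of the three-level linearized difference scheme (described in the context) is bounded in the $L^\infty$-norm: $$\|U^n\|_\infty\le C_*,\qquad \|V^n\|_\infty\le C_*,\qquad 1\le n\le N.$$
   Context: Continuous problem. Let $1<\alpha\le 2$, $T>0$, $a<b$, $i=\sqrt{-1}$, and let $\upsilon_1,\upsilon_2>0$ and $\eta_m,\kappa_m,\zeta_m,\delta_m,\beta_m,\gamma_m$ ($m=1,2$) be real constants. The complex-valued functions $u,v$ satisfy, for $x\in(a,b)$, $0<t<T$, $$u_t+(\upsilon_1+i\eta_1)(-\Delta)^{\alpha/2}u+\big((\kappa_1+i\zeta_1)|u|^2+(\delta_1+i\beta_1)|v|^2\big)u-\gamma_1u=0,$$ $$v_t+(\upsilon_2+i\eta_2)(-\Delta)^{\alpha/2}v+\big((\kappa_2+i\zeta_2)|u|^2+(\delta_2+i\beta_2)|v|^2\big)v-\gamma_2v=0,$$ with $u(x,0)=u_0(x)$, $v(x,0)=v_0(x)$ and homogeneous Dirichlet conditions $u=v=0$ at $x=a,b$; no distinction is made between the solution on $\mathbb R$ and the solution on $[a,b]$, i.e. $u,v$ are regarded as extended by zero outside $[a,b]$. $(-\Delta)^{\alpha/2}$ is the fractional Laplacian in $x$ on $\mathbb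 R$ (Fourier multiplier $|\xi|^\alpha$; $(-\Delta)^{\alpha/2}=-\partial_x^2$ if $\alpha=2$). ''Smooth enough'' means that $u,v$ have as many bounded continuous derivatives in $t$ and $x$ (the zero extensions, in $x\in\mathbb R$) as are needed for second-order consistency of the discretization; in particular in $x$ the functions are $C^5(\mathbb R)$ with derivatives up to order five in $L^1(\mathbb R)$. Grid. For positive integers $M,N$: $h=(b-a)/M$, $\tau=T/N$, $x_j=a+jh$, $t_n=n\tau$. For grid functions write $U^{\bar n}_j=\tfrac12(U^{n+1}_j+U^{n-1}_j)$, $\delta_tU^n_j=\frac{U^{n+1}_j-U^{n-1}_j}{2\tau}$. For $U=(U_0,\dots,U_M)$ with $U_0=U_M=0$: $\|U\|_\infty=\max_{1\le j\le M-1}|U_j|$ and $$\Delta_h^\alpha U_j=\frac1{h^\alpha}\sum_{k=1}^{M-1}c^\alpha_{j-k}U_k\ (1\le j\le M-1),\qquad c^\alpha_k=\frac{(-1)^k\Gamma(\alpha+1)}{\Gamma(\frac\alpha2-k+1)\Gamma(\frac\alpha2+k+1)},$$ with $1/\Gamma=0$ at the poles of $\Gamma$. Scheme. For $0<j<M$ and $1\le n\le N-1$: $$\delta_tU^n_j+(\upsilon_1+i\eta_1)\Delta_h^\alpha U^{\bar n}_j+\big((\kappa_1+i\zeta_1)|U^n_j|^2+(\delta_1+i\beta_1)|V^n_j|^2\big)U^{\bar n}_j-\gamma_1U^{\bar n}_j=0,$$ $$\delta_tV^n_j+(\upsilon_2+i\eta_2)\Delta_h^\alpha V^{\bar n}_j+\big((\kappa_2+i\zeta_2)|U^n_j|^2+(\delta_2+i\beta_2)|V^n_j|^2\big)V^{\bar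 n}_j-\gamma_2V^{\bar n}_j=0,$$ with $U^0_j=u_0(x_j)$, $V^0_j=v_0(x_j)$ ($0<j<M$), $U^n_0=U^n_M=V^n_0=V^n_M=0$ ($0\le n\le N$), and first step, for $0<j<M$, $$U^1_j=U^0_j-\tau\Big((\upsilon_1+i\eta_1)\Delta_h^\alpha U^0_j+\big((\kappa_1+i\zeta_1)|U^0_j|^2+(\delta_1+i\beta_1)|V^0_j|^2\big)U^0_j-\gamma_1U^0_j\Big),$$ $$V^1_j=V^0_j-\tau\Big((\upsilon_2+i\eta_2)\Delta_h^\alpha V^0_j+\big((\kappa_2+i\zeta_2)|U^0_j|^2+(\delta_2+i\beta_2)|V^0_j|^2\big)V^0_j-\gamma_2V^0_j\Big).$$ Constants $\tau_0,h_0$. They are positive constants such that, for some $C_0>0$ independent of $\tau$ and $h$, whenever $\tau<\tau_0$ and $h<h_0$ the solution of the scheme satisfies $\max_{1\le j\le M-1}|u(x_j,t_n)-U^n_j|\le C_0(\tau^2+h^2)$ and $\max_{1\le j\le M-1}|v(x_j,t_n)-V^n_j|\le C_0(\tau^2+h^2)$ for $1\le n\le N$. *)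

(* Defs.v *)
From Stdlib Require Import Reals List ZArith.
From Coquelicot Require Import Coquelicot.
Open Scope R_scope.

(** ** Gamma function *)

(* Euler's integral; it is the Gamma function for [0 < x] only. *)
Definition Gamma_pos (x : R) : R :=
  RInt_gen (fun t => Rpower t (x - 1) * exp (- t))
           (at_right 0) (Rbar_locally p_infty).

Fixpoint rising_factorial (x : R) (n : nat) : R :=
  match n with
  | O => 1
  | S m => rising_factorial x m * (x + INR m)
  end.

(* 1 / Gamma on the whole real line, through the functional equation
   Gamma (x + n) = x (x + 1) ... (x + n - 1) Gamma x.  Here [n] is the least
   natural number with 0 < x + n, so that n = 0 if 0 < x, and the product
   vanishes exactly at the poles x = 0, -1, -2, ... of Gamma. *)
Definition inv_Gamma (x : R) : R :=
  let n := Z.to_nat (up (- x)) in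
  rising_factorial x n / Gamma_pos (x + INR n).

(** ** Fractional Laplacian on the real line *)

Definition cis (theta : R) : C := (cos theta, sin theta).

(* |xi| ^ alpha; [Rpower 0 alpha] is not 0, hence the case distinction. *)
Definition abs_power (alpha xi : R) : R :=
  if Req_EM_T xi 0 then 0 else Rpower (Rabs xi) alpha.

Definition is_integral_R (f : R -> C) (l : C) : Prop :=
  is_RInt_gen (V := C_R_NormedModule) f
    (Rbar_locally m_infty) (Rbar_locally p_infty) l.

Definition is_fourier (f fhat : R -> C) : Prop :=
  forall xi : R,
    is_integral_R (fun x => Cmult (cis (- (x * xi))) (f x)) (fhat xi).

(* [l] is the value at [x] of (-Delta)^(alpha/2) f, i.e. the inverse Fourier
   transform of |xi|^alpha fhat(xi); all integrals are required to converge. *)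
Definition is_frac_laplacian (alpha : R) (f : R -> C) (x : R) (l : C) : Prop :=
  exists (fhat : R -> C) (I : C),
    is_fourier f fhat /\
    is_integral_R
      (fun xi => Cmult (RtoC (abs_power alpha xi))
                       (Cmult (cis (x * xi)) (fhat xi))) I /\
    l = Cmult (RtoC (/ (2 * PI))) I.

(** ** Continuous problem *)

Record coefficients : Type := Coefficients {
  upsilon : R; eta : R; kappa : R; zeta : R; delta : R; beta : R; gamma : R
}.

Definition diffusion (p : coefficients) : C := (upsilon p, eta p).

(* ((kappa + i zeta)|u|^2 + (delta + i beta)|v|^2) w - gamma w *)
Definition reaction (p : coefficients) (u v w : C) : C :=
  Cminus
    (Cmult (Cplus (Cmult (kappa p, zeta p) (RtoC (Cmod u ^ 2)))
                  (Cmult (delta p, beta p) (RtoC (Cmod v ^ 2)))) w)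
    (Cmult (RtoC (gamma p)) w).

(* The equation satisfied by [w], which is [u] or [v], at the point (x, t). *)
Definition gl_equation (alpha : R) (p : coefficients) (u v w : R -> R -> C)
    (x t : R) : Prop :=
  exists wt Lw : C,
    is_derive (V := C_R_NormedModule) (fun s => w x s) t wt /\
    is_frac_laplacian alpha (fun y => w y t) x Lw /\
    Cplus (Cplus wt (Cmult (diffusion p) Lw)) (reaction p (u x t) (v x t) (w x t))
    = RtoC 0.

(* Functions of (x, t) with x on the whole real line: they are the extensions
   by zero of functions on [a, b], which contains the boundary conditions. *)
Definition exact_solution (alpha T a b : R) (p1 p2 : coefficients)
    (u0 v0 : R -> C) (u v : R -> R -> C) : Prop :=
  (forall x t, a < x < b -> 0 < t < T ->
     gl_equation alpha p1 u v u x t /\ gl_equation alpha p2 u v v x t) /\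
  (forall x, a < x < b -> u x 0 = u0 x /\ v x 0 = v0 x) /\
  (forall x t, x <= a \/ b <= x -> 0 <= t <= T ->
     u x t = RtoC 0 /\ v x t = RtoC 0).

Definition bounded_continuous (T : R) (g : R -> R -> C) : Prop :=
  continuous_on (T := prod_UniformSpace R_UniformSpace R_UniformSpace)
    (U := C_UniformSpace)
    (fun p => 0 <= snd p <= T) (fun p => g (fst p) (snd p)) /\
  exists B : R, forall x t, 0 <= t <= T -> Cmod (g x t) <= B.

(* Three derivatives in t (those of order >= 1 on (0, T) extend continuously to
   [0, T]) and five in x, all bounded and continuous on R x [0, T], those in x
   being moreover in L^1(R).  This is what second-order consistency uses: the
   equation itself turns time differences of (-Delta)^(alpha/2) w into time
   differences of w_t and of the reaction term, so no mixed derivative is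
   needed. *)
Definition smooth_enough (T : R) (w : R -> R -> C) : Prop :=
  (exists Dt : nat -> R -> R -> C,
     (forall x t, 0 <= t <= T -> Dt 0%nat x t = w x t) /\
     (forall k x t, (k < 3)%nat -> 0 < t < T ->
        is_derive (V := C_R_NormedModule)
          (fun s => Dt k x s) t (Dt (S k) x t)) /\
     (forall k, (k <= 3)%nat -> bounded_continuous T (Dt k))) /\
  (exists Dx : nat -> R -> R -> C,
     (forall x t, 0 <= t <= T -> Dx 0%nat x t = w x t) /\
     (forall k x t, (k < 5)%nat -> 0 <= t <= T ->
        is_derive (V := C_R_NormedModule)
          (fun y => Dx k y t) x (Dx (S k) x t)) /\
     (forall k, (k <= 5)%nat -> bounded_continuous T (Dx k)) /\
     (forall k t, (k <= 5)%nat -> 0 <= t <= T ->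
        ex_RInt_gen (fun x => Cmod (Dx k x t))
          (Rbar_locally m_infty) (Rbar_locally p_infty))).

(** ** Difference scheme *)

Definition mesh (a b : R) (M : nat) : R := (b - a) / INR M.
Definition time_step (T : R) (N : nat) : R := T / INR N.
Definition grid_point (a b : R) (M j : nat) : R := a + INR j * mesh a b M.
Definition grid_time (T : R) (N n : nat) : R := INR n * time_step T N.

(* max_{1 <= j <= M-1} |U_j|, and 0 if there is no interior grid point. *)
Definition grid_sup_norm (M : nat) (U : nat -> C) : R :=
  fold_right Rmax 0 (map (fun j => Cmod (U j)) (seq 1 (M - 1))).

Definition frac_coeff (alpha : R) (k : Z) : R :=
  powerRZ (-1) k * Gamma_pos (alpha + 1)
  * inv_Gamma (alpha / 2 - IZR k + 1) * inv_Gamma (alpha / 2 + IZR k + 1).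

Definition discrete_frac_laplacian (alpha h : R) (M : nat) (U : nat -> C)
    (j : nat) : C :=
  Cmult (RtoC (/ Rpower h alpha))
    (sum_n_m
       (fun k => Cmult (RtoC (frac_coeff alpha (Z.of_nat j - Z.of_nat k))) (U k))
       1 (M - 1)).

Definition time_average (W : nat -> nat -> C) (n j : nat) : C :=
  Cmult (RtoC (/ 2)) (Cplus (W (S n) j) (W (n - 1)%nat j)).

Definition time_difference (tau : R) (W : nat -> nat -> C) (n j : nat) : C :=
  Cmult (RtoC (/ (2 * tau))) (Cminus (W (S n) j) (W (n - 1)%nat j)).

(* Grid functions are written [W n j]: time level [n], grid point [j]. *)
Definition scheme_equation (alpha h tau : R) (M : nat) (p : coefficients)
    (U V W : nat -> nat -> C) (n j : nat) : Prop :=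
  Cplus
    (Cplus (time_difference tau W n j)
           (Cmult (diffusion p)
              (discrete_frac_laplacian alpha h M (time_average W n) j)))
    (reaction p (U n j) (V n j) (time_average W n j))
  = RtoC 0.

Definition first_step (alpha h tau : R) (M : nat) (p : coefficients)
    (U V W : nat -> nat -> C) (j : nat) : Prop :=
  W 1%nat j =
  Cminus (W 0%nat j)
    (Cmult (RtoC tau)
       (Cplus (Cmult (diffusion p) (discrete_frac_laplacian alpha h M (W 0%nat) j))
              (reaction p (U 0%nat j) (V 0%nat j) (W 0%nat j)))).

Definition scheme_solution (alpha T a b : R) (p1 p2 : coefficients)
    (u0 v0 : R -> C) (M N : nat) (U V : nat -> nat -> C) : Prop :=
  let h := mesh a b M in
  let tau := time_step T N in
  (forall n j, (1 <= n < N)%nat -> (0 < j < M)%nat ->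
     scheme_equation alpha h tau M p1 U V U n j /\
     scheme_equation alpha h tau M p2 U V V n j) /\
  (forall j, (0 < j < M)%nat ->
     U 0%nat j = u0 (grid_point a b M j) /\
     V 0%nat j = v0 (grid_point a b M j)) /\
  (forall n, (n <= N)%nat ->
     U n 0%nat = RtoC 0 /\ U n M = RtoC 0 /\
     V n 0%nat = RtoC 0 /\ V n M = RtoC 0) /\
  (forall j, (0 < j < M)%nat ->
     first_step alpha h tau M p1 U V U j /\
     first_step alpha h tau M p2 U V V j).

Definition grid_error (T a b : R) (M N : nat) (w : R -> R -> C)
    (W : nat -> nat -> C) (n : nat) : R :=
  grid_sup_norm M
    (fun j => Cminus (w (grid_point a b M j) (grid_time T N n)) (W n j)).

Definition convergence_thresholds (alpha T a b : R) (p1 p2 : coefficients)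
    (u0 v0 : R -> C) (u v : R -> R -> C) (tau0 h0 : R) : Prop :=
  0 < tau0 /\ 0 < h0 /\
  exists C0 : R, 0 < C0 /\
    forall M N : nat, (0 < M)%nat -> (0 < N)%nat ->
      time_step T N < tau0 -> mesh a b M < h0 ->
      forall U V : nat -> nat -> C,
        scheme_solution alpha T a b p1 p2 u0 v0 M N U V ->
        forall n, (1 <= n <= N)%nat ->
          grid_error T a b M N u U n
            <= C0 * (time_step T N ^ 2 + mesh a b M ^ 2) /\
          grid_error T a b M N v V n
            <= C0 * (time_step T N ^ 2 + mesh a b M ^ 2).

(* Main.v *)
Require Import Defs.
From Stdlib Require Import Reals List Lia Lra.
From Coquelicot Require Import Coquelicot.
Open Scope R_scope.

(** The convergence estimate puts the discrete solution within
    [C0 * (tau ^ 2 + h ^ 2)] of the exact one at every grid point, and a smooth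
    exact solution is bounded on R x [0, T].  Since [tau < tau0] and [h < h0],
    the triangle inequality bounds the discrete solution by
    [B + C0 * (tau0 ^ 2 + h0 ^ 2)], where [B] bounds the exact solution; this
    does not involve the mesh sizes. *)

Lemma Cmod_le_grid_sup_norm (M : nat) (W : nat -> C) (j : nat) :
  (0 < j < M)%nat -> Cmod (W j) <= grid_sup_norm M W.
Proof.
intros Hj; unfold grid_sup_norm.
assert (Hin : In j (seq 1 (M - 1))) by (apply in_seq; lia).
induction (seq 1 (M - 1)) as [|k l IH]; simpl in *; [easy|].
destruct Hin as [->|Hin].
- apply Rmax_l.
- eapply Rle_trans; [apply IH, Hin | apply Rmax_r].
Qed.

(** The bound must be nonnegative because the norm is 0, and not a supremum over
    the empty set, when there is no interior grid point. *)
Lemma grid_sup_norm_le (M : nat) (W : nat -> C) (B : R) :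
  0 <= B -> (forall j, (0 < j < M)%nat -> Cmod (W j) <= B) ->
  grid_sup_norm M W <= B.
Proof.
intros HB HW; unfold grid_sup_norm.
assert (Hl : forall j, In j (seq 1 (M - 1)) -> Cmod (W j) <= B)
  by (intros j Hj; apply HW; apply in_seq in Hj; lia).
induction (seq 1 (M - 1)) as [|k l IH]; simpl in *; [easy|].
apply Rmax_lub; auto.
Qed.

Lemma grid_sup_norm_ge0 (M : nat) (W : nat -> C) : 0 <= grid_sup_norm M W.
Proof.
unfold grid_sup_norm; induction (seq 1 (M - 1)) as [|k l IH]; simpl; [lra|].
eapply Rle_trans; [apply IH | apply Rmax_r].
Qed.

Lemma grid_sup_norm_le_approx (M : nat) (w W : nat -> C) (B : R) :
  0 <= B -> (forall j, (0 < j < M)%nat -> Cmod (w j) <= B) ->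
  grid_sup_norm M W <= B + grid_sup_norm M (fun j => Cminus (w j) (W j)).
Proof.
intros HB Hw.
assert (He := grid_sup_norm_ge0 M (fun j => Cminus (w j) (W j))).
apply grid_sup_norm_le; [lra|]; intros j Hj.
replace (W j) with (Cplus (w j) (Copp (Cminus (w j) (W j)))) by ring.
eapply Rle_trans; [apply Cmod_triangle|]; rewrite Cmod_opp.
apply Rplus_le_compat; [now apply Hw|].
now apply (Cmod_le_grid_sup_norm M (fun k => Cminus (w k) (W k))).
Qed.

Lemma smooth_enough_bounded (T : R) (w : R -> R -> C) :
  0 < T -> smooth_enough T w ->
  exists B, 0 <= B /\ forall x t, 0 <= t <= T -> Cmod (w x t) <= B.
Proof.
intros HT [[Dt [HD0 [_ HDb]]] _].
destruct (HDb 0%nat ltac:(lia)) as [_ [B HB]].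
assert (Hw : forall x t, 0 <= t <= T -> Cmod (w x t) <= B)
  by (intros x t Ht; rewrite <- HD0 by exact Ht; now apply HB).
exists B; split; [|exact Hw].
apply Rle_trans with (Cmod (w 0 0)); [apply Cmod_ge_0 | apply Hw; lra].
Qed.

Lemma grid_time_bounds (T : R) (N n : nat) :
  0 < T -> (0 < N)%nat -> (n <= N)%nat -> 0 <= grid_time T N n <= T.
Proof.
intros HT HN Hn; unfold grid_time, time_step.
apply lt_INR in HN; apply le_INR in Hn; simpl in HN.
assert (Hn0 := pos_INR n).
replace (INR n * (T / INR N)) with (INR n * T / INR N) by (field; lra).
split; [apply Rle_div_r | apply Rle_div_l]; nra.
Qed.

Lemma grid_sup_norm_le_grid_error (T a b : R) (M N n : nat)
    (w : R -> R -> C) (W : nat -> nat -> C) (B : R) :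
  0 < T -> (0 < N)%nat -> (n <= N)%nat -> 0 <= B ->
  (forall x t, 0 <= t <= T -> Cmod (w x t) <= B) ->
  grid_sup_norm M (W n) <= B + grid_error T a b M N w W n.
Proof.
intros HT HN Hn HB Hw.
apply (grid_sup_norm_le_approx M
         (fun j => w (grid_point a b M j) (grid_time T N n))); [exact HB|].
intros j _; apply Hw; now apply grid_time_bounds.
Qed.

Theorem theorem2 (alpha T a b : R) (p1 p2 : coefficients)
    (u0 v0 : R -> C) (u v : R -> R -> C) (tau0 h0 : R)
    (Halpha : 1 < alpha <= 2) (HT : 0 < T) (Hab : a < b)
    (Hupsilon1 : 0 < upsilon p1) (Hupsilon2 : 0 < upsilon p2)
    (Hsol : exact_solution alpha T a b p1 p2 u0 v0 u v)
    (Hu : smooth_enough T u) (Hv : smooth_enough T v)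
    (Hconv : convergence_thresholds alpha T a b p1 p2 u0 v0 u v tau0 h0) :
  exists Cstar : R,
    forall M N : nat, (0 < M)%nat -> (0 < N)%nat ->
      time_step T N < tau0 -> mesh a b M < h0 ->
      forall U V : nat -> nat -> C,
        scheme_solution alpha T a b p1 p2 u0 v0 M N U V ->
        forall n : nat, (1 <= n <= N)%nat ->
          grid_sup_norm M (U n) <= Cstar /\ grid_sup_norm M (V n) <= Cstar.
Proof.
destruct Hconv as [_ [_ [C0 [HC0 Herr]]]].
destruct (smooth_enough_bounded T u HT Hu) as [Bu [HBu Hub]].
destruct (smooth_enough_bounded T v HT Hv) as [Bv [HBv Hvb]].
exists (Bu + Bv + C0 * (tau0 ^ 2 + h0 ^ 2)).
intros M N HM HN Htau Hh U V HUV n Hn.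
destruct (Herr M N HM HN Htau Hh U V HUV n Hn) as [HeU HeV].
assert (HsU := grid_sup_norm_le_grid_error T a b M N n u U Bu
                 HT HN (proj2 Hn) HBu Hub).
assert (HsV := grid_sup_norm_le_grid_error T a b M N n v V Bv
                 HT HN (proj2 Hn) HBv Hvb).
assert (Htau_pos : 0 < time_step T N)
  by (apply Rdiv_lt_0_compat; [lra | now apply lt_0_INR]).
assert (Hh_pos : 0 < mesh a b M)
  by (apply Rdiv_lt_0_compat; [lra | now apply lt_0_INR]).
assert (Hrate : C0 * (time_step T N ^ 2 + mesh a b M ^ 2)
                <= C0 * (tau0 ^ 2 + h0 ^ 2)).
{ apply Rmult_le_compat_l; [lra|].
  apply Rplus_le_compat; apply pow_incr; lra. }
lra.
Qed.
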